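(* There is a function $f$, defined for all sufficiently small $\varepsilon>0$, with $f(\varepsilon)=\Theta\big(\varepsilon^2/\log(1/\varepsilon)\big)$, such that for every field $K$, for every sufficiently small $\varepsilon>0$, and for all $n$, we have $\mathcal{R}_{H_n}\big(2^{\,n-f(\varepsilon)n}\big)\le 2^{n(1+\varepsilon)}$ over $K$.
   Context: For $n\ge 1$, the Walsh–Hadamard matrix $H_n$ is the $2^n\times 2^n$ matrix whose rows and columns are indexed by the vectors of $\{0,1\}^n$ (in lexicographic order) with $H_n(u,v)=(-1)^{\langle u,v\rangle}$, where $\langle u,v\rangle=\sum_{k=1}^n u_k v_k$; it is viewed as a matrix over the field $K$ (entries $\pm1\in K$). For a matrix $A$ over a field $K$ and a number $r$, the rigidity $\mathcal{R}_A(r)$ over $K$ is the minimum number of entries of $A$ that must be changed (to arbitrary elements of $K$) so that the resulting matrix has rank at most $r$ over $K$. *)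

(* Defs.v *)
From HB Require Import structures.
From mathcomp Require Import all_boot all_order all_algebra.
From mathcomp Require Import all_classical all_reals all_analysis.

Set Implicit Arguments.
Unset Strict Implicit.
Unset Printing Implicit Defensive.

Import Order.TTheory GRing.Theory Num.Theory numFieldNormedType.Exports.

Local Open Scope classical_set_scope.
Local Open Scope ring_scope.

(* The i-th vector of {0,1}^n in lexicographic order: coordinate 0 is the most
   significant binary digit of i. *)
Definition lexvec (n : nat) (i : 'I_(2 ^ n)) : {ffun 'I_n -> bool} :=
  [ffun k : 'I_n => odd (i %/ 2 ^ (n - k.+1))].

Definition inner (n : nat) (u v : {ffun 'I_n -> bool}) : nat :=
  (\sum_(k < n) u k * v k)%N.

Definition walsh_hadamard (K : fieldType) (n : nat) : 'M[K]_(2 ^ n) :=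
  \matrix_(i, j) (-1) ^+ inner (lexvec i) (lexvec j).

Definition changed_entries (K : fieldType) (m n : nat) (A B : 'M[K]_(m, n)) : nat :=
  #|[pred ij : 'I_m * 'I_n | A ij.1 ij.2 != B ij.1 ij.2]|.

(* The infimum is a minimum as soon as 0 <= r (rigidity_attained); for r < 0 no
   matrix has rank at most r and the value is +oo. *)
Definition rigidity (R : realType) (K : fieldType) (m n : nat)
    (A : 'M[K]_(m, n)) (r : R) : \bar R :=
  ereal_inf [set ((changed_entries A B)%:R)%:E
            | B in [set B : 'M[K]_(m, n) | (\rank B)%:R <= r]].

Lemma rigidity_attained (R : realType) (K : fieldType) (m n : nat)
    (A : 'M[K]_(m, n)) (r : R) : 0 <= r ->
  exists2 B : 'M[K]_(m, n), (\rank B)%:R <= r &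
    rigidity A r = ((changed_entries A B)%:R)%:E.
Proof.
move=> r0.
pose P d := `[< exists2 B : 'M[K]_(m, n), (\rank B)%:R <= r &
                 changed_entries A B = d >].
have exP : exists d, P d.
  exists (changed_entries A 0); apply/asboolP; exists 0 => //.
  by rewrite mxrank0.
case: (ex_minnP exP) => d /asboolP[B rB Bd] dmin.
exists B => //; apply/le_anti/andP; split.
  by apply: ereal_inf_lbound; exists B.
apply: le_ereal_inf_tmp => _ [C rC <-].
rewrite lee_fin ler_nat Bd; apply: dmin.
by apply/asboolP; exists C.
Qed.

(* Main.v *)
Require Import Defs.
From mathcomp Require Import all_boot all_order all_algebra.
From mathcomp Require Import ring lra zify.
From mathcomp Require Import all_classical all_reals all_analysis.

Set Implicit Arguments.
Unset Strict Implicit.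
Unset Printing Implicit Defensive.

Import Order.TTheory GRing.Theory Num.Theory numFieldNormedType.Exports.

Local Open Scope ring_scope.

(* Assume 2 != 0 in K (otherwise H_n has rank 1).  For n = 2h m + r, group
   2h m coordinates into m blocks of 2h.  Up to signs and a permutation of the
   columns, the block matrix H_2h is 2^h times a matrix with an eigenbasis of
   characters and eigenvalues +1, -1, the latter occurring (4^h - 2^h)/2 times.
   Hence in the m-th tensor power the eigenvalue of a tensor product of
   eigenvectors is (-1)^j, where j counts the factors of eigenvalue -1.  Replace
   (-1)^j by a polynomial g(j) of degree at most d which agrees with it on d+1
   consecutive integers around m/2.  The matrix with eigenvalues g(j) is
   supported on pairs of indices that differ in at most d blocks, hence sparse,
   and the difference has rank at most the number of eigenvectors with j outside
   the window, which the Chernoff bound makes small.  Blocks of length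
   h ~ log(1/e) with d ~ e m / 4 give the rate e^2 / log(1/e): the cost
   log(1/e) of choosing which d blocks differ is then absorbed by the block
   length.  For n = O(log(1/e)/e^2) the rank need only drop by a constant factor,
   for which a single block (m = 1, d = 0) suffices. *)

(** * Newton interpolation on a window of integers *)

(** Newton's forward differences: interpolate [h j.+1 - h j], then sum by Pascal's rule, which moves
    each coefficient to the next binomial. The binomial basis avoids dividing by factorials, which
    may vanish in [K]. *)
Lemma window_interpolation (K : fieldType) (d s : nat) (h : nat -> K) :
  exists c : nat -> K, forall j, (s <= j <= s + d)%N ->
    h j = \sum_(i < d.+1) c i * 'C(j, i)%:R.
Proof.
elim: d h => [|d IHd] h.
  exists (fun=> h s) => j; rewrite addn0 -eqn_leq => /eqP <-.
  by rewrite big_ord_recl big_ord0 bin0 mulr1 addr0.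
have [c hc] := IHd (fun j => h j.+1 - h j).
pose S j := \sum_(i < d.+1) c i * 'C(j, i.+1)%:R.
(* The constant term makes the formula exact at [j = s]. *)
exists (fun i => if i is i'.+1 then c i' else h s - S s) => j /andP[sj].
rewrite big_ord_recl bin0 mulr1 -/(S j) -(subnKC sj) leq_add2l.
elim: (j - s)%N => [|k IHk] kd; first by rewrite addn0 subrK.
rewrite addnS -(subrK (h (s + k)%N) (h (s + k).+1)) hc ?leq_addr ?leq_add2l //.
rewrite IHk 1?ltnW // addrCA; congr (_ + _); rewrite -big_split /=.
by apply: eq_bigr => i _; rewrite binS natrD mulrDr addrC.
Qed.

(** * Low rank plus sparse decompositions *)

(** The factorization through [C] encodes rank at most [r] for arbitrary finite index types; [Z] can
    be a whole eigenbasis and [C] the part that is used. *)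
Definition low_rank_plus_sparse (K : fieldType) (X Y : finType)
    (A : X -> Y -> K) (r s : nat) : Prop :=
  exists (Z : finType) (C : {set Z}) (a : X -> Z -> K) (b : Z -> Y -> K),
    (#|C| <= r)%N /\
    (#|[set xy | (A xy.1 xy.2 != \sum_(z in C) a xy.1 z * b z xy.2)%R]| <= s)%N.

Lemma low_rank_plus_sparseW (K : fieldType) (X Y : finType)
    (A : X -> Y -> K) (r s r' s' : nat) : (r <= r')%N -> (s <= s')%N ->
  low_rank_plus_sparse A r s -> low_rank_plus_sparse A r' s'.
Proof.
move=> rr ss [Z [C [a [b [Cr Es]]]]]; exists Z, C, a, b.
by split; [apply: leq_trans rr | apply: leq_trans ss].
Qed.

(** Scaling and reindexing act on the two factors separately; injectivity sends distinct wrong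
    entries of [B] to distinct wrong entries of [A]. *)
Lemma low_rank_plus_sparse_pullback (K : fieldType) (X Y X' Y' : finType)
    (A : X -> Y -> K) (B : X' -> Y' -> K) (f : X' -> X) (g : Y' -> Y)
    (u : X' -> K) (v : Y' -> K) (r s : nat) :
  injective f -> injective g ->
  (forall x y, B x y = u x * v y * A (f x) (g y)) ->
  low_rank_plus_sparse A r s -> low_rank_plus_sparse B r s.
Proof.
move=> finj ginj BA [Z [C [a [b [Cr Es]]]]].
exists Z, C, (fun x z => u x * a (f x) z), (fun z y => v y * b z (g y)).
split=> //; apply: leq_trans Es.
have hinj : injective (fun xy => (f xy.1, g xy.2)).
  by move=> [x y] [x' y'] /= [/finj -> /ginj ->].
rewrite -(card_imset _ hinj); apply/subset_leq_card/fintype.subsetP => w /imsetP[xy].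
rewrite !inE => /negP ne ->; apply/negP => /= /eqP e; apply: ne.
rewrite BA e mulr_sumr; apply/eqP/eq_bigr => z _; ring.
Qed.

(** [rho] is kept exactly: each term of the factorization splits into [#|T|] terms, and a wrong
    entry of [A] spoils at most one [#|T|] by [#|T|] block. *)
Lemma low_rank_plus_sparse_tensor (K : fieldType) (X Y T : finType)
    (A : X -> Y -> K) (rho : T -> T -> K) (r s : nat) :
  low_rank_plus_sparse A r s ->
  low_rank_plus_sparse (fun (x : X * T) (y : Y * T) => A x.1 y.1 * rho x.2 y.2)
    (r * #|T|) (s * #|T| ^ 2).
Proof.
move=> [Z [C [a [b [Cr Es]]]]].
exists (Z * T)%type, (finset.setX C [set: T]),
  (fun x z => a x.1 z.1 * (x.2 == z.2)%:R), (fun z y => b z.1 y.1 * rho z.2 y.2).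
split; first by rewrite cardsX cardsT leq_mul2r Cr orbT.
set E := [set _ | _] in Es.
pose f (xy : (X * T) * (Y * T)) := ((xy.1.1, xy.2.1), (xy.1.2, xy.2.2)).
have finj : injective f by move=> [[? ?] [? ?]] [[? ?] [? ?]] [] -> -> -> ->.
have -> : (#|T| ^ 2)%N = #|[set: T * T]| by rewrite cardsT card_prod mulnn.
apply: (@leq_trans #|finset.setX E [set: T * T]|); last by rewrite cardsX leq_mul2r Es orbT.
rewrite -(card_imset _ finj); apply/subset_leq_card/fintype.subsetP => w /imsetP[[[x t] [y t']]].
rewrite !inE /= andbT => /negP ne ->; apply/negP => /= /eqP e; apply: ne.
rewrite e big_distrl /= (eq_bigl (fun z : Z * T => (z.1 \in C) && true)); last first.
  by move=> z; rewrite !inE.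
rewrite -(pair_big (fun z => z \in C) xpredT
  (fun z q => a x z * (t == q)%:R * (b z y * rho q t'))) /=.
apply/eqP/eq_bigr => z _; rewrite (bigD1 t) //= eqxx big1 => [|q /negbTE].
  by rewrite addr0 mulr1 mulrA.
by rewrite eq_sym => ->; rewrite mulr0 mul0r.
Qed.

(** The matrix is J ⊗ A + c E ⊗ A, with J all ones and E the matrix unit at [t0]. The first summand
    factors exactly through [X]; only the second is approximated, and its errors lie in one
    block. *)
Lemma low_rank_plus_sparse_corner (K : fieldType) (X Y T : finType)
    (A : X -> Y -> K) (t0 : T) (c : K) (r s : nat) :
  low_rank_plus_sparse A r s ->
  low_rank_plus_sparse (fun (x : X * T) (y : Y * T) =>
      A x.1 y.1 * (1 + c * ((x.2 == t0) && (y.2 == t0))%:R)) (#|X| + r) s.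
Proof.
move=> [Z [C [a [b [Cr Es]]]]].
exists (X + Z)%type, [set z | if z is inr z' then z' \in C else true],
  (fun x z => match z with inl x' => (x.1 == x')%:R
                         | inr z' => c * (x.2 == t0)%:R * a x.1 z' end),
  (fun z y => match z with inl x' => A x' y.1
                         | inr z' => (y.2 == t0)%:R * b z' y.1 end).
split.
  have -> : [set z : X + Z | if z is inr z' then z' \in C else true] =
      [set inl x | x in [set: X]] :|: [set inr z | z in C].
    apply/finset.setP => -[x|z]; rewrite !inE.
      by rewrite imset_f ?inE.
    have -> : (inr z \in [set inl x | x in [set: X]]) = false :> bool.
      by apply/imsetP => -[].
    apply/idP/imsetP => [zC|[z' z'C []->//]]; by exists z.
  apply: leq_trans (leq_card_setU _ _) _; apply: leq_add.
    by rewrite (leq_trans (leq_imset_card _ _)) // cardsT.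
  by rewrite (leq_trans (leq_imset_card _ _)).
apply: leq_trans Es.
pose f (xy : X * Y) := ((xy.1, t0), (xy.2, t0)).
apply: leq_trans (leq_imset_card f _).
apply/subset_leq_card/fintype.subsetP => -[[x t] [y t']]; rewrite !inE /=.
rewrite big_sumType /= (eq_bigl xpredT); last by move=> i; rewrite inE.
rewrite (bigD1 x) //= eqxx mul1r big1 => [|x' /negbTE]; last first.
  by rewrite eq_sym => ->; rewrite mul0r.
rewrite addr0 mulrDr mulr1 (inj_eq (addrI _)) => ne.
have [tt0 tt0'] : t = t0 /\ t' = t0.
  have : (t == t0) && (t' == t0).
    apply/negPn/negP => /negbTE tt; move/eqP: ne; apply.
    rewrite tt mulr0 mulr0 big1 // => z _; move/negbT: tt; rewrite negb_and.
    by case/orP => /negbTE ->; rewrite ?(mulr0, mul0r).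
  by case/andP => /eqP -> /eqP ->.
apply/imsetP; exists (x, y); last by rewrite /f /= tt0 tt0'.
rewrite inE /=; apply: contraNneq ne => ->; rewrite tt0 tt0' eqxx /= !mulr1 mulrC mulr_sumr.
apply/eqP; rewrite (eq_bigl (mem C)); last by move=> z; rewrite inE.
by apply: eq_bigr => z _; ring.
Qed.

(** * Tensor powers and the weight of an index *)

Lemma tensor_sum (K : comPzRingType) (I Q : finType) (F : I -> Q -> K) :
  \sum_(z : {ffun I -> Q}) \prod_i F i (z i) = \prod_i \sum_q F i q.
Proof. by rewrite bigA_distr_bigA. Qed.

Definition weight (I Q : finType) (p : pred Q) (z : {ffun I -> Q}) : nat :=
  #|[set i | p (z i)]|.

Lemma prod_weight (K : comPzRingType) (I Q : finType) (p : pred Q) (t : K)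
    (z : {ffun I -> Q}) : \prod_i t ^+ p (z i) = t ^+ weight p z.
Proof.
rewrite prodrXr /weight -sum1_card [in RHS]big_mkcond /=.
by congr (_ ^+ _); apply: eq_bigr => i _; rewrite inE; case: (p _).
Qed.

Lemma weight_moment (K : comPzRingType) (I Q : finType) (p : pred Q) (t : K) :
  \sum_(z : {ffun I -> Q}) t ^+ weight p z = (\sum_q t ^+ p q) ^+ #|I|.
Proof.
under eq_bigr do rewrite -prod_weight.
by rewrite (tensor_sum (fun _ q => t ^+ p q)) prodr_const.
Qed.

Lemma bin_weight (K : comPzRingType) (I Q : finType) (p : pred Q)
    (z : {ffun I -> Q}) (k : nat) :
  'C(weight p z, k)%:R =
    \sum_(B : {set I} | #|B| == k) \prod_i ((i \in B) ==> p (z i))%:R :> K.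
Proof.
rewrite -cards_draws -sum1_card natr_sum.
under eq_bigl do rewrite inE andbC.
rewrite big_mkcondr; apply: eq_bigr => B _.
case: ifP => [/fintype.subsetP BS|/negbT/fintype.subsetPn[i iB]].
  rewrite big1 // => i _; case: (boolP (i \in B)) => // /BS.
  by rewrite inE => ->.
by rewrite inE => /negbTE pi; rewrite (bigD1 i) //= iB pi mul0r.
Qed.

(* The polynomial g(j) is expanded in binomials: 'C(j, i) is the sum over all
   i-subsets B of the indicators of "all factors in B have eigenvalue -1". *)
Lemma tensor_power_low_rank_plus_sparse (K : fieldType) (Q : finType) (m : nat)
    (U V M : Q -> Q -> K) (p : pred Q) (s d : nat) :
  (forall x y, \sum_z U x z * V z y = (x == y)%:R) ->
  (forall x y, M x y = \sum_z (-1) ^+ p z * (U x z * V z y)) ->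
  low_rank_plus_sparse
    (fun x y : {ffun 'I_m -> Q} => \prod_l M (x l) (y l))
    #|[set z : {ffun 'I_m -> Q} | ~~ (s <= weight p z <= s + d)%N]|
    #|[set z : {ffun 'I_m -> Q * Q} | (weight (fun q => q.1 != q.2) z <= d)%N]|.
Proof.
move=> UV MUV.
have [c hc] := window_interpolation d s (fun j => (-1) ^+ j : K).
pose g j : K := \sum_(i < d.+1) c i * 'C(j, i)%:R.
pose E (x y z : {ffun 'I_m -> Q}) := \prod_l (U (x l) (z l) * V (z l) (y l)).
exists {ffun 'I_m -> Q}, [set z | ~~ (s <= weight p z <= s + d)%N],
  (* These eigenvalues vanish inside the window, so summing over the complement of the window loses
     nothing. *)
  (fun (x z : {ffun 'I_m -> Q}) => ((-1) ^+ weight p z - g (weight p z)) * \prod_l U (x l) (z l)),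
  (fun z y : {ffun 'I_m -> Q} => \prod_l V (z l) (y l)).
split=> //.
pose f (xy : {ffun 'I_m -> Q} * {ffun 'I_m -> Q}) := [ffun l => (xy.1 l, xy.2 l)].
have finj : injective f.
  move=> [x y] [x' y'] /ffunP e; congr pair; apply/ffunP => l;
    by move: (e l); rewrite !ffunE => -[].
rewrite -(card_imset _ finj); apply/subset_leq_card/fintype.subsetP => w /imsetP[[x y]].
rewrite !inE /= => ne ->; rewrite leqNgt; apply: contraNN ne => ham.
have ham' (B : {set 'I_m}) : (#|B| <= d)%N ->
    \sum_(z : {ffun 'I_m -> Q}) (\prod_l ((l \in B) ==> p (z l))%:R) * E x y z = 0.
  move=> Bd.
  (* More than [d] blocks differ, so one of them lies outside [B]; its factor is an entry of the
     identity off the diagonal, hence 0. *)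
  have [l lB xyl] : exists2 l, l \notin B & x l != y l.
    have : ~~ ([set l | x l != y l] \subset B).
      apply: contraL ham => /subset_leq_card le; rewrite -leqNgt.
      apply: leq_trans Bd; apply: leq_trans le.
      by apply/subset_leq_card/fintype.subsetP => l; rewrite !inE ffunE.
    by case/fintype.subsetPn => l; rewrite inE; exists l.
  under eq_bigr do rewrite -big_split /=.
  rewrite (tensor_sum (fun l q => ((l \in B) ==> p q)%:R * (U (x l) q * V q (y l)))).
  rewrite (bigD1 l) //= (negbTE lB) /=.
  by under eq_bigr do rewrite mul1r; rewrite UV (negbTE xyl) mul0r.
have gE : \sum_(z : {ffun 'I_m -> Q}) g (weight p z) * E x y z = 0.
  under eq_bigr do rewrite mulr_suml.
  rewrite exchange_big /= big1 // => i _.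
  under eq_bigr do rewrite bin_weight -mulrA.
  rewrite -mulr_sumr; under eq_bigr do rewrite mulr_suml.
  rewrite exchange_big /= big1 ?mulr0 // => B /eqP Bi.
  by rewrite ham' // Bi -ltnS.
have -> : \prod_l M (x l) (y l) = \sum_(z : {ffun 'I_m -> Q}) (-1) ^+ weight p z * E x y z.
  under eq_bigr do rewrite MUV.
  rewrite -(tensor_sum (fun l q => (-1) ^+ p q * (U (x l) q * V q (y l)))).
  by apply: eq_bigr => z _; rewrite big_split /= prod_weight.
apply/eqP; rewrite -[LHS]subr0 -[X in _ - X]gE -sumrB [RHS]big_mkcond /=.
apply: eq_bigr => z _; rewrite inE -mulrBl.
case: ifPn => [_|/negPn win]; first by rewrite /E big_split /= mulrA.
by rewrite [X in X - _](hc _ win) subrr mul0r.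
Qed.

(** * The Hadamard block and its eigenvalues *)

(* The coordinates of a block come in pairs, i.e. z = (u, v) with u, v in
   {0,1}^h, and [bent z] is <u, v> mod 2.  Since bent (x + y) = bent x + bent y +
   <x, swap_pairs y>, the swapped Hadamard matrix is up to signs a convolution. *)
Definition pair_char (K : fieldType) (a b : bool * bool) : K :=
  (-1) ^+ (a.1 * b.1 + a.2 * b.2)%N.

(** This is H_2h with its coordinates grouped in pairs. *)
Definition char_of (K : fieldType) (h : nat) (x y : {ffun 'I_h -> bool * bool}) : K :=
  \prod_i pair_char K (x i) (y i).

Definition swap_pairs (h : nat) (x : {ffun 'I_h -> bool * bool}) :
    {ffun 'I_h -> bool * bool} := [ffun i => ((x i).2, (x i).1)].

Definition bent (h : nat) (z : {ffun 'I_h -> bool * bool}) : bool :=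
  odd (weight (fun q => q.1 && q.2) z).

Lemma swap_pairsK (h : nat) : involutive (@swap_pairs h).
Proof. by move=> x; apply/ffunP => i; rewrite !ffunE /=; case: (x i). Qed.

Lemma sum_bool_pair (K : nmodType) (F : bool * bool -> K) :
  \sum_q F q = F (true, true) + F (true, false) + (F (false, true) + F (false, false)).
Proof.
rewrite (eq_bigr (fun q => F (q.1, q.2))) => [|[]//].
by rewrite -(pair_big xpredT xpredT (fun a b => F (a, b))) /= !big_bool.
Qed.

Lemma bent_sign (K : fieldType) (h : nat) (z : {ffun 'I_h -> bool * bool}) :
  (-1) ^+ bent z = \prod_i (-1) ^+ ((z i).1 && (z i).2) :> K.
Proof. by rewrite signr_odd -prod_weight. Qed.

Lemma char_of_orthogonal (K : fieldType) (h : nat) (x y : {ffun 'I_h -> bool * bool}) :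
  \sum_z char_of K x z * char_of K z y = 4 ^+ h * (x == y)%:R.
Proof.
under eq_bigr do rewrite -big_split /=.
rewrite (tensor_sum (fun i q => pair_char K (x i) q * pair_char K q (y i))).
have E a b : \sum_q pair_char K a q * pair_char K q b = 4 * (a == b)%:R.
  by rewrite sum_bool_pair /pair_char; case: a b => [[] []] [[] []] /=;
    rewrite ?addn0 ?add0n ?addn1 /=; ring.
under eq_bigr do rewrite E.
rewrite big_split /= prodr_const card_ord; congr (_ * _).
case: eqP => [->|/eqP xy]; first by rewrite big1 // => i _; rewrite eqxx.
have [i xyi] : exists i, x i != y i.
  apply/existsP; rewrite -negb_forall; apply: contra xy => /forallP e.
  by apply/eqP/ffunP => i; apply/eqP; exact: e i.
by rewrite (bigD1 i) //= (negbTE xyi) mul0r.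
Qed.

(** [bent] is a bent function and its own dual. The sum factors over the pairs, which leaves a check
    of 16 cases. *)
Lemma bent_transform (K : fieldType) (h : nat) (x y : {ffun 'I_h -> bool * bool}) :
  \sum_z (-1) ^+ bent z * (char_of K x z * char_of K z y) =
    2 ^+ h * ((-1) ^+ bent x * (-1) ^+ bent y * char_of K x (swap_pairs y)).
Proof.
under eq_bigr do rewrite bent_sign -!big_split /=.
rewrite (tensor_sum (fun i q => (-1) ^+ (q.1 && q.2) *
   (pair_char K (x i) q * pair_char K q (y i)))).
rewrite !bent_sign -!big_split /= -[h in 2 ^+ h]card_ord -prodr_const -big_split /=.
apply: eq_bigr => i _; rewrite ffunE sum_bool_pair /pair_char.
by case: (x i) (y i) => [[] []] [[] []] /=; rewrite ?addn0 ?add0n ?addn1 /=; ring.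
Qed.

(** The block matrix H satisfies H^2 = 4^h I, so 2^-h H is its own inverse and provides both [U] and
    [V]; [M] is the signed and swapped H, scaled by 2^-h. *)
Lemma char_of_power_low_rank_plus_sparse (K : fieldType) (h m s d : nat) :
  (2 : K) != 0 ->
  low_rank_plus_sparse
    (fun x y : {ffun 'I_m -> {ffun 'I_h -> bool * bool}} =>
       \prod_l char_of K (x l) (y l))
    #|[set z : {ffun 'I_m -> {ffun 'I_h -> bool * bool}} |
        ~~ (s <= weight (@bent h) z <= s + d)%N]|
    #|[set z : {ffun 'I_m -> {ffun 'I_h -> bool * bool} * {ffun 'I_h -> bool * bool}} |
        (weight (fun q => q.1 != q.2) z <= d)%N]|.
Proof.
move=> K2; have K2h : 2 ^+ h != 0 :> K by rewrite expf_neq0.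
pose M (x y : {ffun 'I_h -> bool * bool}) :=
  (2 ^+ h)^-1 * ((-1) ^+ bent x * (-1) ^+ bent y * char_of K x (swap_pairs y)).
have E4 : 4 ^+ h = 2 ^+ h * 2 ^+ h :> K by rewrite -exprMn; congr (_ ^+ _); ring.
have orth (x y : {ffun 'I_h -> bool * bool}) :
    \sum_z (2 ^+ h)^-1 * char_of K x z * ((2 ^+ h)^-1 * char_of K z y) =
    (x == y)%:R.
  under eq_bigr => z _ do rewrite mulrACA.
  by rewrite -mulr_sumr char_of_orthogonal E4; field.
have ME (x y : {ffun 'I_h -> bool * bool}) : M x y = \sum_z (-1) ^+ bent z *
    ((2 ^+ h)^-1 * char_of K x z * ((2 ^+ h)^-1 * char_of K z y)).
  under eq_bigr => z _ do rewrite [X in _ * X]mulrACA (mulrCA ((-1) ^+ _)).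

  by rewrite -mulr_sumr bent_transform /M; field.
have tensor := tensor_power_low_rank_plus_sparse m s d orth ME.
pose G : finType := {ffun 'I_m -> {ffun 'I_h -> bool * bool}}.
(* Undo the normalization: unswap the columns, remove the signs, restore 2^h in every block. *)
apply: (@low_rank_plus_sparse_pullback K G G G G _ _ id
  (fun y : G => [ffun l => swap_pairs (y l)])
  (fun x : G => \prod_l (2 ^+ h * (-1) ^+ bent (x l)))
  (fun y : G => \prod_l (-1) ^+ bent (swap_pairs (y l))) _ _ _ _ _ tensor).
- by [].
- move=> x y /ffunP e; apply/ffunP => l; move: (e l); rewrite !ffunE.
  exact: (can_inj (@swap_pairsK h)).
move=> x y; rewrite -!big_split /=; apply: eq_bigr => l _.
rewrite /M ffunE swap_pairsK.
by case: (bent (x l)); case: (bent _); rewrite /= ?expr0 ?expr1; field.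
Qed.

(** * From tensor powers to H_n and its rigidity *)

(** The inner product is invariant under a common permutation of coordinates, so any bijection of
    the positions with blocks, pairs and remainder will do. *)
Lemma walsh_tensor_embedding (h m r : nat) :
  exists2 F : {ffun 'I_(2 * h * m + r) -> bool} ->
      {ffun 'I_m -> {ffun 'I_h -> bool * bool}} * {ffun 'I_r -> bool},
    injective F
  & forall (K : fieldType) u v, (-1) ^+ inner u v =
      (\prod_l char_of K ((F u).1 l) ((F v).1 l)) * (-1) ^+ inner (F u).2 (F v).2.
Proof.
set n := (2 * h * m + r)%N.
pose I : finType := ('I_m * 'I_h * bool + 'I_r)%type.
have cI : #|I| = n.
  by rewrite card_sum !card_prod card_bool !card_ord /n; lia.
pose pos (i : I) : 'I_n := cast_ord cI (enum_rank i).
have posK : cancel (fun k => enum_val (cast_ord (esym cI) k)) pos.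
  by move=> k; rewrite /pos enum_valK cast_ordKV.
have Kpos : cancel pos (fun k => enum_val (cast_ord (esym cI) k)).
  by move=> i; rewrite /pos cast_ordK enum_rankK.
exists (fun u => ([ffun l => [ffun i => (u (pos (inl (l, i, true))),
                                    u (pos (inl (l, i, false))))]],
              [ffun t => u (pos (inr t))])).
  move=> u v [/ffunP e1 /ffunP e2]; apply/ffunP => k; rewrite -(posK k).
  case: (enum_val _) => [[[l i] b]|t]; last by move: (e2 t); rewrite !ffunE.
  move: (e1 l); rewrite !ffunE => /ffunP/(_ i); rewrite !ffunE => -[].
  by case: b.
move=> K u v; rewrite /inner -!prodrXr.
rewrite (reindex pos) /=; last by exists (fun k => enum_val (cast_ord (esym cI) k)) => x _.
rewrite big_sumType /=; congr (_ * _); last by apply: eq_bigr => t _; rewrite !ffunE.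
pose G l i b : K := (-1) ^+ (u (pos (inl (l, i, b))) * v (pos (inl (l, i, b)))).
transitivity (\prod_(p : 'I_m * 'I_h * bool) G p.1.1 p.1.2 p.2).
  by apply: eq_bigr => -[[l i] b].
rewrite -(pair_big xpredT xpredT (fun (li : 'I_m * 'I_h) b => G li.1 li.2 b)) /=.
rewrite -(pair_big xpredT xpredT (fun l i => \prod_b G l i b)) /=.
apply: eq_bigr => l _; rewrite /char_of; apply: eq_bigr => i _.
by rewrite !ffunE /pair_char /= big_bool exprD.
Qed.

Lemma rank_sum_outer (K : fieldType) (m n : nat) (Z : finType) (C : {set Z})
    (a : 'I_m -> Z -> K) (b : Z -> 'I_n -> K) :
  (\rank (\matrix_(i, j) \sum_(z in C) a i z * b z j)%R <= #|C|)%N.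
Proof.
have -> : \matrix_(i, j) \sum_(z in C) a i z * b z j =
    \sum_(z in C) (\col_i a i z) *m (\row_j b z j).
  apply/matrixP => i j; rewrite !mxE summxE; apply: eq_bigr => z _.
  by rewrite !mxE big_ord_recl big_ord0 !mxE addr0.
rewrite -sum1_card.
elim/big_ind2: _ => [|? ? ? ? le1 le2|z _]; first by rewrite mxrank0.
  by apply: leq_trans (mxrank_add _ _) _; exact: leq_add.
by apply: leq_trans (mxrankM_maxl _ _) _; exact: rank_leq_col.
Qed.

Lemma rigidity_le (R : realType) (K : fieldType) (m n : nat) (A : 'M[K]_(m, n))
    (N S : nat) (r s : R) :
  low_rank_plus_sparse (fun i j => A i j) N S -> N%:R <= r -> S%:R <= s ->
  (rigidity A r <= s%:E)%E.
Proof.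
move=> [Z [C [a [b [CN ES]]]]] Nr Ss.
apply: (@le_trans _ _ (S%:R)%:E); last by rewrite lee_fin.
pose B : 'M[K]_(m, n) := \matrix_(i, j) \sum_(z in C) a i z * b z j.
apply: (@le_trans _ _ ((changed_entries A B)%:R)%:E).
  apply: ereal_inf_lbound; exists B => //=.
  by apply: le_trans Nr; rewrite ler_nat (leq_trans (rank_sum_outer _ _ _)).
rewrite lee_fin ler_nat (leq_trans _ ES) // -cardsE.
apply/subset_leq_card/fintype.subsetP => -[i j]; rewrite !inE /=.
by rewrite mxE.
Qed.

Lemma lexvec_inj (n : nat) : injective (@lexvec n).
Proof.
have bits k (i j : nat) : (i < 2 ^ k)%N -> (j < 2 ^ k)%N ->
    (forall b, (b < k)%N -> odd (i %/ 2 ^ b) = odd (j %/ 2 ^ b)) -> i = j.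
  elim: k i j => [|k IHk] i j; first by case: i => //; case: j.
  rewrite expnS mul2n -!ltn_half_double => ik jk e.
  rewrite -(odd_double_half i) -(odd_double_half j); congr (_ + _.*2)%N.
    by have := e 0%N isT; rewrite expn0 !divn1 => ->.
  apply: IHk => // b bk; have := e b.+1 bk.
  by rewrite expnS !divnMA !divn2.
move=> i j /ffunP e; apply: val_inj; apply: (bits n); rewrite ?ltn_ord // => b bn.
(* The most significant digit comes first, so digit [b] is coordinate [n - b.+1]. *)
have kn : (n - b.+1 < n)%N by lia.
move: (e (Ordinal kn)); rewrite !ffunE /=.
by have -> : (n - (n - b.+1).+1 = b)%N by lia.
Qed.

Lemma walsh_low_rank_plus_sparse (K : fieldType) (h m r N S : nat) :
  low_rank_plus_sparse
    (fun x y : {ffun 'I_m -> {ffun 'I_h -> bool * bool}} * {ffun 'I_r -> bool} =>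
       (\prod_l char_of K (x.1 l) (y.1 l)) * (-1) ^+ inner x.2 y.2) N S ->
  low_rank_plus_sparse (fun i j => walsh_hadamard K (2 * h * m + r) i j) N S.
Proof.
have [F Finj FE] := walsh_tensor_embedding h m r.
have Linj := inj_comp Finj (@lexvec_inj _).
apply: (@low_rank_plus_sparse_pullback _ _ _ _ _ _ _ _ _ (fun=> 1) (fun=> 1) _ _
  Linj Linj) => i j.
by rewrite mxE !mul1r; exact: FE.
Qed.

Lemma walsh_char2 (K : fieldType) (n : nat) : (2 : K) = 0 ->
  low_rank_plus_sparse (fun i j => walsh_hadamard K n i j) 1 0.
Proof.
move=> K2; exists unit, [set: unit], (fun _ _ => 1), (fun _ _ => 1).
split; first by rewrite cardsT card_unit.
rewrite leqn0 cards_eq0; apply/eqP/setP => -[i j]; rewrite !inE mxE /=.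
rewrite big_const cardsT card_unit /= mulr1 addr0.
have -> : (-1 : K) = 1 by apply/eqP; rewrite -subr_eq0 -opprD oppr_eq0 -K2; apply/eqP; ring.
by rewrite expr1n eqxx.
Qed.

(** * Moments and Chernoff bounds *)

Lemma card_bool_pairs (h : nat) : #|{: {ffun 'I_h -> bool * bool}}| = (4 ^ h)%N.
Proof. by rewrite card_ffun card_prod card_bool card_ord. Qed.

Lemma sum_bent_sign (K : fieldType) (h : nat) :
  \sum_(z : {ffun 'I_h -> bool * bool}) (-1) ^+ bent z = 2 ^+ h :> K.
Proof.
under eq_bigr do rewrite bent_sign.
rewrite (tensor_sum (fun _ q => (-1) ^+ (q.1 && q.2))) prodr_const card_ord.
by rewrite sum_bool_pair /=; congr (_ ^+ _); ring.
Qed.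

(** On a bit, [t ^+ b] is affine in the sign [(-1) ^+ b], so the sign sum 2^h determines the
    moment. *)
Lemma sum_bent (R : realFieldType) (h : nat) (t : R) :
  \sum_(z : {ffun 'I_h -> bool * bool}) t ^+ bent z =
    (1 + t) / 2 * 4 ^+ h + (1 - t) / 2 * 2 ^+ h.
Proof.
rewrite (eq_bigr (fun z => (1 + t) / 2 + (1 - t) / 2 * (-1) ^+ bent z)); last first.
  by move=> z _; case: bent => /=; rewrite ?expr0 ?expr1; field.
rewrite big_split /= sumr_const -mulr_sumr sum_bent_sign card_bool_pairs.
by rewrite -[_ *+ (4 ^ h)%N]mulr_natr natrX.
Qed.

Lemma sum_not_bent (R : realFieldType) (h : nat) (t : R) :
  \sum_(z : {ffun 'I_h -> bool * bool}) t ^+ (~~ bent z) =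
    (1 + t) / 2 * 4 ^+ h + (t - 1) / 2 * 2 ^+ h.
Proof.
rewrite (eq_bigr (fun z => (1 + t) / 2 + (t - 1) / 2 * (-1) ^+ bent z)); last first.
  by move=> z _; case: bent => /=; rewrite ?expr0 ?expr1; field.
rewrite big_split /= sumr_const -mulr_sumr sum_bent_sign card_bool_pairs.
by rewrite -[_ *+ (4 ^ h)%N]mulr_natr natrX.
Qed.

Lemma markov_ge (R : realFieldType) (X : finType) (w : X -> nat) (a : nat) (t : R) :
  1 <= t -> #|[set z | (a <= w z)%N]|%:R * t ^+ a <= \sum_z t ^+ w z.
Proof.
move=> t1; have t0 : 0 <= t by apply: le_trans t1.
rewrite -sum1_card natr_sum mulr_suml [leRHS](bigID [in [set z | (a <= w z)%N]]) /=.
rewrite -[leLHS]addr0; apply: lerD; last by apply: sumr_ge0 => z _; exact: exprn_ge0.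
by apply: ler_sum => z; rewrite inE mul1r => aw; exact: ler_weXn2l.
Qed.

Lemma markov_le (R : realFieldType) (X : finType) (w : X -> nat) (a : nat) (t : R) :
  0 <= t <= 1 -> #|[set z | (w z <= a)%N]|%:R * t ^+ a <= \sum_z t ^+ w z.
Proof.
move=> /andP[t0 t1].
rewrite -sum1_card natr_sum mulr_suml [leRHS](bigID [in [set z | (w z <= a)%N]]) /=.
rewrite -[leLHS]addr0; apply: lerD; last by apply: sumr_ge0 => z _; exact: exprn_ge0.
by apply: ler_sum => z; rewrite inE mul1r => aw; exact: ler_wiXn2l.
Qed.

(** Chernoff bound for the Hamming distance: each row of a block contributes 1 for the equal pair
    and [t] for each other pair. *)
Lemma sparse_count (R : realFieldType) (Q : finType) (m d : nat) (t : R) :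
  0 <= t <= 1 ->
  #|[set z : {ffun 'I_m -> Q * Q} | (weight (fun q => q.1 != q.2) z <= d)%N]|%:R * t ^+ d
    <= (#|Q|%:R * (1 + #|Q|%:R * t)) ^+ m.
Proof.
move=> t01; apply: le_trans (markov_le _ _ t01) _.
rewrite weight_moment card_ord; have t0 : 0 <= t by case/andP: t01.
apply: lerXn2r; rewrite ?nnegrE.
- by apply: sumr_ge0 => q _; exact: exprn_ge0.
- by rewrite mulr_ge0 ?addr_ge0 ?mulr_ge0.
rewrite -(pair_big xpredT xpredT (fun a b => t ^+ (a != b))) /=.
have le1 a : \sum_(b : Q) t ^+ (a != b) <= 1 + #|Q|%:R * t.
  rewrite (bigD1 a) //= eqxx expr0 lerD2l.
  rewrite (eq_bigr (fun=> t)) => [|b /negbTE]; last by rewrite eq_sym => ->; rewrite expr1.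
  rewrite sumr_const -[t *+ _]mulr_natl ler_wpM2r // ler_nat; exact: max_card.
apply: le_trans (ler_sum _ (fun a _ => le1 a)) _.
by rewrite sumr_const [leRHS]mulr_natl.
Qed.

Lemma weight_predC (I Q : finType) (p : pred Q) (z : {ffun I -> Q}) :
  (weight p z + weight (fun q => ~~ p q) z = #|I|)%N.
Proof.
rewrite /weight -(cardsC [set i | p (z i)]); congr (_ + _)%N.
by apply: eq_card => i; rewrite !inE.
Qed.

(** Both tails become upper tails, for [bent] and for its negation. The base [(1 + y) ^+ 2] bounds
    twice the weight, which avoids half-integers; dividing by [(1 + y) ^+ m] removes the linear term
    in [y] from the main part of the moment. *)
Lemma bent_tail (R : realFieldType) (h m d : nat) (y : R) : (d <= m)%N -> 0 <= y ->
  #|[set z : {ffun 'I_m -> {ffun 'I_h -> bool * bool}} |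
      ~~ ((m - d)./2 <= weight (@bent h) z <= (m - d)./2 + d)%N]|%:R * (1 + y) ^+ d
  <= 2 * (4 ^+ h * (1 + (y ^+ 2 / 2 + y / 2 ^+ h))) ^+ m.
Proof.
move=> dm y0; set W := [set _ | _].
have t0 : 0 < 1 + y by rewrite ltr_pwDl.
have t1 : 1 <= 1 + y by rewrite lerDl.
have l0 : 0 < 2 ^+ h :> R by rewrite exprn_gt0.
set M := 4 ^+ h * _.
have E4 : 4 ^+ h = 2 ^+ h * 2 ^+ h :> R by rewrite -exprMn; congr (_ ^+ _); ring.
have M0 : 0 <= M.
  by rewrite mulr_ge0 ?exprn_ge0 // !addr_ge0 ?divr_ge0 ?exprn_ge0 // ltW.
have tail (p : pred {ffun 'I_h -> bool * bool}) :
    \sum_q ((1 + y) ^+ 2) ^+ p q <= (1 + y) * M ->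
    #|[set z : {ffun 'I_m -> {ffun 'I_h -> bool * bool}} |
       (m + d <= 2 * weight p z)%N]|%:R * (1 + y) ^+ d <= M ^+ m.
  move=> le1; rewrite -(ler_pM2r (exprn_gt0 m t0)) -mulrA -exprD [(d + m)%N]addnC.
  apply: le_trans (markov_ge (fun z => 2 * weight p z)%N _ t1) _.
  under eq_bigr do rewrite exprM.
  rewrite weight_moment card_ord -exprMn [M * _]mulrC; apply: lerXn2r; rewrite ?nnegrE //.
    by apply: sumr_ge0 => q _; rewrite !exprn_ge0 // ltW.
  by rewrite mulr_ge0 // ltW.
have sub : W \subset [set z | (m + d <= 2 * weight (@bent h) z)%N] :|:
                     [set z | (m + d <= 2 * weight (fun q => ~~ bent q) z)%N].
  apply/fintype.subsetP => z; rewrite !inE; have := weight_predC (@bent h) z; rewrite card_ord.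
  (* The window has [d + 1] points, so rounding [(m - d) / 2] down still leaves twice one of the
     weights at least [m + d]. *)
  have := odd_double_half (m - d); lia.
apply: (@le_trans _ _ ((#|[set z : {ffun 'I_m -> {ffun 'I_h -> bool * bool}} |
    (m + d <= 2 * weight (@bent h) z)%N]|%:R +
   #|[set z : {ffun 'I_m -> {ffun 'I_h -> bool * bool}} |
    (m + d <= 2 * weight (fun q => ~~ bent q) z)%N]|%:R) * (1 + y) ^+ d)).
  rewrite ler_wpM2r ?exprn_ge0 ?(ltW t0) // -natrD ler_nat.
  by apply: leq_trans (subset_leq_card sub) _; exact: leq_card_setU.
have ME : (1 + y) * M = (1 + y) * 4 ^+ h + (1 + y) * (y ^+ 2 / 2) * 4 ^+ h
    + (1 + y) * y * 2 ^+ h.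
  by rewrite /M E4; field; rewrite gt_eqF.
have p4 : 0 < 4 ^+ h :> R by rewrite exprn_gt0.
have b4 : 0 <= y * y * y * 4 ^+ h by rewrite !mulr_ge0 // ltW.
have b2 : 0 <= y * 2 ^+ h by rewrite !mulr_ge0 // ltW.
have b3 : 0 <= y * y * 2 ^+ h by rewrite !mulr_ge0 // ltW.
rewrite mulrDl [leRHS]mulr_natl mulr2n; apply: lerD; apply: tail.
  by rewrite sum_bent ME; nra.
by rewrite sum_not_bent ME; nra.
Qed.

(** * Decompositions of H_n with explicit parameters *)

(** For one block the window is {0}. The weight is 0 or 1, so the moment at [t = -1] gives 4^h - 2 N
    = 2^h. *)
Lemma bent_single (h : nat) :
  (2 * #|[set z : {ffun 'I_1 -> {ffun 'I_h -> bool * bool}} |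
     ~~ (0 <= weight (@bent h) z <= 0 + 0)%N]| <= 4 ^ h)%N.
Proof.
set N := #|_|.
have E : (4 ^+ h - 2 * N%:R = 2 ^+ h :> rat)%R.
  have := weight_moment 'I_1 (@bent h) (-1 : rat).
  rewrite card_ord expr1 sum_bent_sign => <-.
  rewrite /N -sum1_card natr_sum mulr_sumr big_mkcond /=.
  have -> : 4 ^+ h = \sum_(z : {ffun 'I_1 -> {ffun 'I_h -> bool * bool}}) (1 : rat).
    by rewrite sumr_const card_ffun card_bool_pairs card_ord expn1 natrX.
  rewrite -sumrB; apply: eq_bigr => z _; rewrite inE /= addn0 leqn0.
  have := weight_predC (@bent h) z; rewrite card_ord.
  by case: (weight _ _) => [|[|[]]] //= _; rewrite ?expr0 ?expr1; ring.
rewrite -(ler_nat rat) natrM natrX; have : 0 < 2 ^+ h :> rat by rewrite exprn_gt0.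
lra.
Qed.

(* For odd n, H_n = J (x) A - 2 E_22 (x) A with A = H_(n-1); only the second copy
   of A is approximated, which costs a single changed block. *)
Lemma walsh_three_quarters (K : fieldType) (n : nat) : (2 : K) != 0 -> (0 < n)%N ->
  exists2 N, (4 * N <= 3 * 2 ^ n)%N
    & low_rank_plus_sparse (fun i j => walsh_hadamard K n i j) N (2 ^ n).
Proof.
move=> K2 n0; set h := n./2.
have := char_of_power_low_rank_plus_sparse h 1 0 0 K2.
have := bent_single h; set N := #|_|; set S := #|_| => N2 base.
have S4 : (S <= 4 ^ h)%N.
  (* At [d = 0] and [t = 0] the bound counts only the diagonal. *)
  have t01 : 0 <= (0 : rat) <= 1 by [].
  have := @sparse_count rat {ffun 'I_h -> bool * bool} 1 0 0 t01.
  by rewrite -/S mulr0 addr0 !mulr1 expr1 ler_nat card_bool_pairs.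
have E4 : (4 ^ h = 2 ^ h.*2)%N by rewrite -mul2n expnM.
have := odd_double_half n; rewrite -/h.
case: (boolP (odd n)) => _ nE.
  have -> : n = (2 * h * 1 + 1)%N by lia.
  exists (4 ^ h + N)%N; first by rewrite muln1 expnD mul2n -E4; lia.
  apply: walsh_low_rank_plus_sparse.
  apply: (@low_rank_plus_sparseW _ _ _ _ (4 ^ h + N)%N S) => //.
    by rewrite muln1 expnD mul2n -E4; lia.
  (* H_1 is all ones except for -1 = 1 - 2 at [t0]. *)
  pose t0 : {ffun 'I_1 -> bool} := [ffun=> true].
  have := low_rank_plus_sparse_corner t0 (-2) base.
  rewrite card_ffun card_bool_pairs card_ord expn1.
  apply: (@low_rank_plus_sparse_pullback _ _ _ _ _ _ _ id id (fun=> 1) (fun=> 1)) => //.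
  move=> [x t] [y t'] /=; rewrite !mul1r; congr (_ * _).
  have tE (u : {ffun 'I_1 -> bool}) : (u == t0) = u ord0.
    apply/eqP/idP => [->|u0]; first by rewrite ffunE.
    by apply/ffunP => i; rewrite (ord1 i) ffunE u0.
  rewrite !tE /inner big_ord_recl big_ord0 addn0.
  by case: (t ord0) (t' ord0) => [] [] /=; ring.
have -> : n = (2 * h * 1 + 0)%N by lia.
exists N; first by rewrite muln1 addn0 mul2n -E4; lia.
apply: walsh_low_rank_plus_sparse.
have := low_rank_plus_sparse_tensor
  (fun t t' : {ffun 'I_0 -> bool} => (-1) ^+ inner t t') base.
rewrite card_ffun card_bool card_ord expn0 exp1n !muln1.
by apply: low_rank_plus_sparseW => //; rewrite addn0 mul2n -E4.
Qed.

Lemma walsh_blocks (R : realFieldType) (K : fieldType) (h m r d : nat) (y : R) :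
  (2 : K) != 0 -> (d <= m)%N -> 0 <= y ->
  exists N S,
    [/\ low_rank_plus_sparse (fun i j => walsh_hadamard K (2 * h * m + r) i j) N S,
        N%:R * (1 + y) ^+ d <=
          2 ^+ (2 * h * m + r) * (2 * (1 + (y ^+ 2 / 2 + y / 2 ^+ h)) ^+ m)
      & S%:R <=
          2 ^+ (2 * h * m + r) * 2 ^+ (r + 3 * h * d) * (1 + 1 / 2 ^+ h) ^+ m :> R].
Proof.
move=> K2 dm y0.
have := char_of_power_low_rank_plus_sparse h m (m - d)./2 d K2.
have := bent_tail h dm y0; set N := #|_|; set S := #|_| => N2 base.
exists (N * 2 ^ r)%N, (S * (2 ^ r) ^ 2)%N.
have l0 : 0 < 2 ^+ h :> R by rewrite exprn_gt0.
have E4 : 4 ^+ h = 2 ^+ (2 * h) :> R by rewrite exprM; congr (_ ^+ _); ring.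
split.
- apply: walsh_low_rank_plus_sparse.
  have := low_rank_plus_sparse_tensor
    (fun t t' : {ffun 'I_r -> bool} => (-1) ^+ inner t t') base.
  by rewrite card_ffun card_bool card_ord.
- have r0 : 0 <= 2 ^+ r :> R by rewrite exprn_ge0.
  rewrite natrM natrX mulrAC; apply: le_trans (ler_wpM2r r0 N2) _.
  rewrite exprMn E4 -exprM exprD le_eqVlt; apply/orP; left; apply/eqP; ring.
(* Then 4^h t = 2^-h is small, while t^-d costs only 2^(3hd). *)
pose t : R := (2 ^+ (3 * h))^-1.
have t01 : 0 <= t <= 1.
  by rewrite invr_ge0 exprn_ge0 //= invf_le1 ?exprn_gt0 // exprn_ege1 // ler1n.
have := sparse_count {ffun 'I_h -> bool * bool} m d t01.
rewrite -/S card_bool_pairs natrX.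
have -> : 4 ^+ h * t = 1 / 2 ^+ h.
  rewrite /t E4 (_ : 3 * h = 2 * h + h)%N ?exprD; last by lia.
  by field; rewrite !gt_eqF ?exprn_gt0.
rewrite exprMn exprVn -exprM -ler_pdivlMr ?invr_gt0 ?exprn_gt0 // invrK => le1.
rewrite !natrM !natrX.
have r0 : 0 <= (2 ^+ r) ^+ 2 :> R by rewrite !exprn_ge0.
apply: le_trans (ler_wpM2r r0 le1) _.
rewrite !exprD E4 -!exprM le_eqVlt; apply/orP; left; apply/eqP.
by rewrite (exprM _ r 2); move: (_ ^+ m) => B; ring.
Qed.

(** * Real estimates for the choice of parameters *)

(** Since n e^2 is at least 2^16 L, the remainder r, at most 10 L, is negligible, and m is about n /
    (2h), with h at most 5 L. *)
Lemma block_count_bounds (R : realFieldType) (e L h m r n : R) :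
  0 < e -> e <= 64^-1 -> 1 <= L -> 1 <= h -> h <= 5 * L -> 0 <= m ->
  0 <= r -> r <= 2 * h -> n = 2 * h * m + r -> 2 ^+ 16 * L <= n * e ^+ 2 ->
  [/\ n <= 20 * L * m, 8 <= e * m & 4 * r <= n * e].
Proof.
move=> e0 e1 L1 h1 h5 m0 r0 r2 nE nL.
have n0 : 0 <= n by rewrite nE addr_ge0 // !mulr_ge0 //; lra.
have ne0 : 0 <= n * e by rewrite mulr_ge0 // ltW.
have ne : n * e ^+ 2 <= n * e / 64 by rewrite expr2 mulrA ler_wpM2l.
have ne1 : n * e <= n / 64 by rewrite ler_wpM2l.
have mn : n <= 20 * L * m.
  have : h * m <= 5 * L * m by rewrite ler_wpM2r.
  by clear - nE nL ne ne1 r2 h5 L1; lra.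
split=> //; last by clear - nL ne r2 h5 L1; lra.
have L0 : 0 < L by lra.
have ne2 : n * e <= 20 * L * m * e by rewrite ler_wpM2r // ltW.
rewrite -(ler_pM2l L0); clear - nL ne ne2 L1; lra.
Qed.

(** Natural logarithms, with [a] standing for ln 2. The gain d e / 64 is at least m e^2 / 512, twice
    the Chernoff cost. What remains is at least X / 20480 with X = n e^2 / L, enough for the factor
    2 and the rate X / 2^18 because X is at least 2^16. *)
Lemma rank_exponent (R : realFieldType) (e L m n d a : R) :
  0 < e -> 0 < L -> 0 <= a <= 1 -> n <= 20 * L * m -> 2 ^+ 16 * L <= n * e ^+ 2 ->
  e * m <= 8 * d ->
  n * a + (1 + m * (e ^+ 2 / 1024)) <=
    (n - 2 ^- 18 * (e ^+ 2 / L) * n) * a + d * (e / 64).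
Proof.
move=> e0 L0 /andP[a0 a1] mn nL dm; pose X := n * e ^+ 2 / L.
have XE : 2 ^- 18 * (e ^+ 2 / L) * n = X / 2 ^+ 18 by rewrite /X; field; lra.
have X1 : 2 ^+ 16 <= X by rewrite /X ler_pdivlMr.
have X2 : X <= 20 * (m * e ^+ 2).
  rewrite /X ler_pdivrMr //; have := ler_wpM2r (sqr_ge0 e) mn.
  by congr (_ <= _); ring.
have X3 : X * a <= X by rewrite ler_piMr //; apply: le_trans X1; exact: exprn_ge0.
have d1 : m * e ^+ 2 <= 8 * (d * e).
  by rewrite expr2 mulrA mulrA ler_pM2r // mulrC.
rewrite mulrBl XE; clear - X1 X2 X3 d1; lra.
Qed.

(** Of the budget n e a, the terms in r and d use at most 5/8, and m e^2 at most 1/64. *)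
Lemma sparsity_exponent (R : realFieldType) (e h m r n d a : R) :
  0 < e -> e <= 64^-1 -> 1 <= h -> 0 <= m -> 0 <= r -> 1 / 2 <= a -> n = 2 * h * m + r ->
  4 * r <= n * e -> 4 * d <= e * m ->
  n * a + (r + 3 * h * d) * a + m * e ^+ 2 <= n * (1 + e) * a.
Proof.
move=> e0 e1 h1 m0 r0 a1 nE rn dm.
have hm : m <= h * m by rewrite ler_peMl.
have n0 : 0 <= n by rewrite nE; lra.
have hd : 4 * (h * d) <= h * m * e.
  by rewrite mulrCA -mulrA ler_pM2l ?[m * e]mulrC //; lra.
have hme : 2 * (h * m * e) <= n * e.
  by rewrite nE mulrA mulrA ler_pM2r // lerDl.
have me : m * e ^+ 2 <= h * m * e / 64.
  rewrite expr2 mulrA; apply: ler_pM => //; first by rewrite mulr_ge0 // ltW.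
    exact: ltW.
  by rewrite ler_pM2r.
have ne0 : 0 <= n * e by rewrite mulr_ge0 // ltW.
have t : (r + 3 * h * d) * a <= 5 / 8 * (n * e) * a.
  by rewrite ler_wpM2r; clear - rn hd hme a1; lra.
have u : n * e <= 2 * (n * e * a) by rewrite mulrCA ler_peMr //; lra.
clear - t u me hme ne0; lra.
Qed.

Lemma ln2_ge (R : realType) : 1 / 2 <= ln 2 :> R.
Proof.
rewrite -ler_expR lnK ?posrE //.
have := expR_ge1Dx (- (1 / 2) : R); rewrite expRN.
have p : 0 < expR (1 / 2) :> R by exact: expR_gt0.
rewrite -(ler_pM2r p) mulVf ?gt_eqF // => le1; lra.
Qed.

Lemma ln2_le (R : realType) : ln 2 <= 1 :> R.
Proof.
rewrite -ler_expR lnK ?posrE //.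
by have := expR_ge1Dx (1 : R).
Qed.

Lemma expR_ln2 (R : realType) (n : nat) : 2 ^+ n = expR (n%:R * ln 2) :> R.
Proof. by rewrite expRM_natl lnK ?posrE. Qed.

Lemma powR2E (R : realType) (x : R) : 2 `^ x = expR (x * ln 2).
Proof. by rewrite /powR pnatr_eq0. Qed.

Lemma expR_half_le (R : realType) (y : R) : 0 <= y <= 1 -> expR (y / 2) <= 1 + y.
Proof.
move=> /andP[y0 y1].
have := expR_ge1Dx (- (y / 2)); rewrite expRN.
have p : 0 < expR (y / 2) by exact: expR_gt0.
rewrite -(ler_pM2r p) mulVf ?gt_eqF // => le1; nra.
Qed.

Lemma block_length (R : realType) (e : R) : 0 < e -> 1 <= ln e^-1 ->
  exists2 h : nat, (0 < h)%N /\ h%:R <= 5 * ln e^-1 & 1 / 2 ^+ h <= e ^+ 2.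
Proof.
move=> e0 L1; set L := ln e^-1 in L1 *.
have L0 : 0 <= 4 * L by lra.
have /andP[h1 h2] := truncn_itv L0.
(* As ln 2 is at least 1/2, this length gives 2^h at least exp(2 L) = e^-2; L at least 1 absorbs the
   rounding. *)
exists (Num.truncn (4 * L)).+1.
  by split => //; rewrite -addn1 natrD; lra.
have eE : e^-1 = expR L by rewrite /L lnK // posrE invr_gt0.
rewrite expR_ln2 div1r -[e]invrK eE -expRN -expRN -expRM_natl ler_expR.
have := ln2_ge R; nra.
Qed.

(** * The rate, and the two ranges of n *)

(** At the threshold n e^2 = 2^16 ln(1/e), where the two constructions meet, the exponent drops by
    [rate e * n] = 1/4. *)
Definition rate (R : realType) (e : R) : R := 2 ^- 18 * (e ^+ 2 / ln e^-1).

Lemma rate_const_ge0 (R : realType) : 0 <= 2 ^- 18 :> R.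
Proof. by rewrite invr_ge0 exprn_ge0. Qed.

Lemma rate_ge0 (R : realType) (e : R) : 0 <= ln e^-1 -> 0 <= rate e.
Proof.
by move=> L0; rewrite /rate mulr_ge0 ?rate_const_ge0 // divr_ge0 // sqr_ge0.
Qed.

Lemma walsh_large (R : realType) (K : fieldType) (e : R) (n : nat) :
  (2 : K) != 0 -> 0 < e -> e <= 64^-1 -> 1 <= ln e^-1 ->
  2 ^+ 16 * ln e^-1 <= n%:R * e ^+ 2 ->
  exists N S : nat,
    [/\ low_rank_plus_sparse (fun i j => walsh_hadamard K n i j) N S,
        N%:R <= 2 `^ (n%:R - rate e * n%:R) & S%:R <= 2 `^ (n%:R * (1 + e))].
Proof.
move=> K2 e0 e1 L1 nL.
have [h [h0 hL] lam] := block_length e0 L1.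
rewrite /rate; set L := ln e^-1 in L1 nL hL *.
set m := (n %/ (2 * h))%N; set r := (n %% (2 * h))%N.
have nE : n = (2 * h * m + r)%N by rewrite mulnC; exact: divn_eq.
have rh : (r <= 2 * h)%N by rewrite ltnW // ltn_mod muln_gt0.
have nR : n%:R = 2 * h%:R * m%:R + r%:R :> R by rewrite {1}nE natrD !natrM.
have rR : r%:R <= 2 * h%:R :> R by rewrite -natrM ler_nat.
have h1 : 1 <= h%:R :> R by rewrite ler1n.
have [mn em8 rn] := block_count_bounds e0 e1 L1 h1 hL (ler0n R m) (ler0n R r) rR nR nL.
have em0 : 0 <= e * m%:R / 4 by clear - em8; lra.
(* [d] is e m / 4 rounded down; e m at least 8 keeps it above e m / 8. *)
have /andP[] := truncn_itv em0; set d := Num.truncn _ => d1.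
rewrite -[d.+1%:R]natr1 => d2.
have d4 : 4 * d%:R <= e * m%:R by clear - d1; lra.
have d8 : e * m%:R <= 8 * d%:R by clear - d2 em8; lra.
have dm : (d <= m)%N.
  have em1 : e * m%:R <= 64^-1 * m%:R by rewrite ler_wpM2r.
  have m0 := ler0n R m; rewrite -(ler_nat R); clear - d4 em1 m0; lra.
(* With this [y], both y^2 / 2 and y / 2^h are at most e^2 / 2048, half of the cost allowed per
   block. *)
pose y := e / 32.
have y0 : 0 <= y by clear - e0; rewrite /y; lra.
have y1 : 0 <= y <= 1 by rewrite y0; clear - e1; rewrite /y; lra.
have [N [S []]] := walsh_blocks h r K2 dm y0.
rewrite -nE => lrs Nle Sle; exists N, S; split => //.
  rewrite powR2E -(ler_pM2r (expR_gt0 (d%:R * (y / 2)))).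
  have le1 : expR (d%:R * (y / 2)) <= (1 + y) ^+ d.
    by rewrite expRM_natl lerXn2r ?nnegrE ?expR_ge0 ?expR_half_le // addr_ge0.
  apply: le_trans (ler_wpM2l _ le1) _ => //; apply: le_trans Nle _.
  have yl0 : 0 <= y / 2 ^+ h by rewrite divr_ge0 ?exprn_ge0.
  have B0 : 0 <= 1 + (y ^+ 2 / 2 + y / 2 ^+ h).
    by rewrite !addr_ge0 // mulr_ge0 // sqr_ge0.
  have le2 : (1 + (y ^+ 2 / 2 + y / 2 ^+ h)) ^+ m <= expR (m%:R * (e ^+ 2 / 1024)).
    rewrite expRM_natl lerXn2r ?nnegrE ?expR_ge0 //.
    apply: le_trans (expR_ge1Dx _); rewrite lerD2l.
    have yl : y / 2 ^+ h <= 64^-1 * (e ^+ 2 / 32).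
      apply: (@le_trans _ _ (y * e ^+ 2)).
        by have := ler_wpM2l y0 lam; rewrite mulrA mulr1.
      by rewrite /y mulrAC -mulrA ler_wpM2r // divr_ge0 ?sqr_ge0.
    by rewrite {1}/y exprMn; clear - yl; lra.
  have two : 2 <= expR 1 :> R by have := expR_ge1Dx (1 : R).
  rewrite expR_ln2.
  apply: (@le_trans _ _ (expR (n%:R * ln 2) * (expR 1 * expR (m%:R * (e ^+ 2 / 1024))))).
    by rewrite ler_pM2l ?expR_gt0 //; apply: ler_pM => //; rewrite exprn_ge0.
  rewrite -!expRD ler_expR.
  have -> : y / 2 = e / 64 by rewrite /y; field.
  apply: rank_exponent => //; first by apply: lt_le_trans L1.
  by rewrite ln2_le andbT; apply: le_trans (ln2_ge R).
rewrite powR2E.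
have le3 : (1 + 1 / 2 ^+ h) ^+ m <= expR (m%:R * e ^+ 2).
  rewrite expRM_natl lerXn2r ?nnegrE ?expR_ge0 //.
  by apply: le_trans (expR_ge1Dx _); rewrite lerD2l.
have P0 : 0 <= 2 ^+ n * 2 ^+ (r + 3 * h * d) :> R by rewrite mulr_ge0 // exprn_ge0.
apply: le_trans Sle _; apply: le_trans (ler_wpM2l P0 le3) _.
rewrite !expR_ln2 -!expRD ler_expR natrD !natrM.
by apply: (@sparsity_exponent R e h%:R m%:R) => //; exact: ln2_ge.
Qed.

(** Here [rate e * n] is at most 1/4, and exp(-x) >= 1 - x shows that the permitted rank is at least
    3/4 of 2^n. *)
Lemma walsh_small (R : realType) (K : fieldType) (e : R) (n : nat) :
  (2 : K) != 0 -> (0 < n)%N -> 0 < e -> 0 < ln e^-1 ->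
  n%:R * e ^+ 2 <= 2 ^+ 16 * ln e^-1 ->
  exists N S : nat,
    [/\ low_rank_plus_sparse (fun i j => walsh_hadamard K n i j) N S,
        N%:R <= 2 `^ (n%:R - rate e * n%:R) & S%:R <= 2 `^ (n%:R * (1 + e))].
Proof.
move=> K2 n0 e0 L0 nL; have [N N4 lrs] := walsh_three_quarters K2 n0.
exists N, (2 ^ n)%N; split=> //.
  have q : rate e * n%:R <= 4^-1.
    have X1 : n%:R * e ^+ 2 / ln e^-1 <= 2 ^+ 16 by rewrite ler_pdivrMr.
    have -> : rate e * n%:R = 2 ^- 18 * (n%:R * e ^+ 2 / ln e^-1).
      by rewrite /rate; field; lra.
    by clear - X1; lra.
  have ln20 : 0 <= ln 2 :> R by apply: le_trans (ln2_ge R).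
  have qa : rate e * n%:R * ln 2 <= 4^-1.
    by apply: le_trans q; apply: ler_piMr (ln2_le R); rewrite mulr_ge0 // rate_ge0 // ltW.
  rewrite powR2E mulrBl expRD -expR_ln2.
  have e4 := expR_ge1Dx (- (rate e * n%:R * ln 2)).
  have e34 : 3 / 4 <= expR (- (rate e * n%:R * ln 2)) by clear - e4 qa; lra.
  have p : 0 <= 2 ^+ n :> R by rewrite exprn_ge0.
  apply: le_trans (ler_wpM2l p e34).
  move: N4; rewrite -(ler_nat R) !natrM natrX => N4; clear - N4; lra.
rewrite powR2E natrX expR_ln2 ler_expR ler_wpM2r //.
  by apply: le_trans (ln2_ge R).
by rewrite ler_peMr // lerDl ltW.
Qed.

Local Open Scope classical_set_scope.

(* Landau's Theta only bounds `|f|, so the sign of f is stated separately. *)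
Theorem theorem1p1 (R : realType) :
  exists f : R -> R,
    [/\ f =Theta_(0^'+) (fun e => e ^+ 2 / ln e^-1),
        \forall e \near 0^'+, 0 <= f e
      & forall K : fieldType,
          \forall e \near 0^'+, forall n : nat, (0 < n)%N ->
            (rigidity (walsh_hadamard K n) (2 `^ (n%:R - f e * n%:R))
               <= (2 `^ (n%:R * (1 + e)))%:E)%E].
Proof.
have small : \forall e \near (0 : R)^'+, [/\ 0 < e, e <= 64^-1 & 1 <= ln e^-1].
  near=> e.
  have e0 : 0 < e by near: e; exact: nbhs_right_gt.
  split=> //.
    by near: e; apply: nbhs_right_le; rewrite invr_gt0.
  have : e <= expR (-1).
    by near: e; apply: nbhs_right_le; exact: expR_gt0.
  rewrite -ler_ln ?posrE ?expR_gt0 // expRK lnV ?posrE //.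
  by rewrite lerNr.
exists (@rate R); split.
(* [rate] is a constant multiple of the comparison function, so 2^-18 serves as both constants. *)
- rewrite eqThetaE qualifE; apply/asboolP; exists (2 ^- 18, 2 ^- 18) => /=.
    by rewrite andbb invr_gt0 exprn_gt0.
  by near=> e; rewrite /rate (normrM (2 ^- 18)) (ger0_norm (rate_const_ge0 R)).
- near=> e; have [e0 _ L1] : [/\ 0 < e, e <= 64^-1 & 1 <= ln e^-1] by near: e.
  by rewrite rate_ge0 // (le_trans _ L1).
move=> K; near=> e => n n0.
have [e0 e1 L1] : [/\ 0 < e, e <= 64^-1 & 1 <= ln e^-1] by near: e.
have L0 : 0 < ln e^-1 by apply: lt_le_trans L1.
have [K2|K2] := eqVneq (2 : K) 0.
  apply: (rigidity_le (walsh_char2 n K2)); last by rewrite powR_ge0.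
  (* The exact rank 1 is permitted once the exponent n - [rate e] n is nonnegative. *)
  have r1 : rate e <= 1.
    have q1 : e ^+ 2 / ln e^-1 <= 1.
      rewrite ler_pdivrMr // mul1r; apply: le_trans L1.
      by rewrite expr_le1 ?ltW //; clear - e1; lra.
    by apply: le_trans (ler_wpM2l (rate_const_ge0 R) q1) _; lra.
  rewrite powR2E -[1%:R]expR0 ler_expR mulr_ge0 //.
    by rewrite -[X in X - _]mul1r -mulrBl mulr_ge0 // subr_ge0.
  by apply: le_trans (ln2_ge R).
have [N [S [lrs NR SR]]] : exists N S : nat,
    [/\ low_rank_plus_sparse (fun i j => walsh_hadamard K n i j) N S,
        N%:R <= 2 `^ (n%:R - rate e * n%:R) & S%:R <= 2 `^ (n%:R * (1 + e))].
  by case: (leP (n%:R * e ^+ 2) (2 ^+ 16 * ln e^-1)) => [|/ltW] nL;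
    [apply: walsh_small | apply: walsh_large].
exact: rigidity_le lrs NR SR.
Unshelve. all: by end_near.
Qed.
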